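(* Let $0<\alpha\le1$, $\nu>0$, $\xi>0$. Let $\mathbf{H}=(H_{ij})$ be the one-step transition matrix of the random walk on a finite connected undirected graph with nodes $1,\dots,N$, and let $\mathbf{P}(t)=\sum_{n=0}^{\infty}\mathbf{H}^n\Phi^{(n)}(t)$, $t\in\mathbb{N}_0$, be the transition matrix of the Prabhakar discrete-time random walk, where $\Phi^{(n)}(t)$ are the state probabilities of the Prabhakar discrete-time process (PDTP) with parameters $\alpha,\nu,\xi$; put $\mathbf{P}(t)=0$ for $t<0$. Let $\mathcal{K}(t)$ be the coefficient of $u^t$ in the power series at $u=0$ of $\frac{1}{1-u}\left(1+\frac{(1-u)^{\alpha}}{\xi}\right)^{\nu}$. Then $P_{ij}(0)=\delta_{ij}$ and $\mathbf{P}$ satisfies the Kolmogorov-Feller generalized fractional difference equation $$(1-\hat T)\sum_{k=0}^{t}\mathcal{K}(k)P_{ij}(t-k)-\delta_{ij}\left[\mathcal{K}(t)-\Theta(t-1)\right]=\sum_{r=1}^{N}H_{ir}P_{rj}(t-1),\qquad t\in\mathbb{N}_0,\ 1\le i,j\le N,$$ where $1-\hat T$ acts on the sum as a function of $t$ (which is $0$ for $t<0$).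
   Context: $\mathbb{N}_0=\{0,1,2,\dots\}$. $\hat T$ is the backward shift $(\hat Tg)(t)=g(t-1)$ on functions on $\mathbb{Z}$; $\Theta(t)=1$ for integers $t\ge0$ and $0$ for $t<0$. The graph has symmetric adjacency matrix $A_{ij}\in\{0,1\}$ with $A_{ii}=0$, node degrees $K_i=\sum_jA_{ij}$, and $H_{ij}=A_{ij}/K_i$. The PDTP with parameters $\alpha,\nu,\xi$ is the discrete-time renewal process with arrival times $J_0=0$, $J_n=\sum_{j=1}^nZ_j$, where the $Z_j$ are i.i.d. $\{1,2,\dots\}$-valued with generating function $\mathbb{E}u^{Z_j}=\frac{\xi^{\nu}u}{(\xi+(1-u)^{\alpha})^{\nu}}$, $|u|\le 1$ (principal branches). Its state probabilities are $\Phi^{(n)}(t)=\mathbb{P}(J_n\le t<J_{n+1})$ for $n,t\in\mathbb{N}_0$. *)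

(* Defs.v *)
From mathcomp Require Import all_boot all_order all_algebra.
From mathcomp Require Import all_classical all_reals all_analysis.
From mathcomp Require Import complex.

Set Implicit Arguments.
Unset Strict Implicit.
Unset Printing Implicit Defensive.

Import Order.TTheory GRing.Theory Num.Theory.
Import numFieldNormedType.Exports.

Local Open Scope classical_set_scope.
Local Open Scope ring_scope.
Local Open Scope complex_scope.

(* Argument in ]-pi, pi] for z != 0; the junk value at 0 is harmless below,
   since cpow 0 a = 0 as soon as a != 0. *)
Definition carg (R : realType) (z : R[i]) : R :=
  let theta := acos (complex.Re z / Normc.normc z) in
  if 0 <= complex.Im z then theta else - theta.

(* Principal branch of z ^ a for a real exponent a. *)
Definition cpow (R : realType) (z : R[i]) (a : R) : R[i] :=
  (Normc.normc z `^ a)%:C *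
  (cos (a * carg z) +i* sin (a * carg z)).

(* R[i] carries its topology through its alias R[i]^o. *)
Definition has_power_series_at0 (R : realType) (a : nat -> R[i])
    (f : R[i] -> R[i]) : Prop :=
  \forall u \near (0 : R[i]^o),
    series (fun k => a k * u ^+ k : R[i]^o) @ \oo --> (f u : R[i]^o).

Definition prabhakar_pgf (R : realType) (alpha nu xi : R) (u : R[i]) : R[i] :=
  (xi `^ nu)%:C * u / cpow (xi%:C + cpow (1 - u) alpha) nu.

Definition prabhakar_kernel_gf (R : realType) (alpha nu xi : R) (u : R[i]) :
    R[i] :=
  (1 - u)^-1 * cpow (1 + cpow (1 - u) alpha / xi%:C) nu.

Section probability.
Context d (Omega : measurableType d) (R : realType) (Pr : probability Omega R).

(* Used only for bounded X, so fine never discards an infinite value. *)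
Definition cexpectation (X : Omega -> R[i]) : R[i] :=
  fine ('E_Pr[fun w => complex.Re (X w)])%E +i*
  fine ('E_Pr[fun w => complex.Im (X w)])%E.

Definition mutually_independent d' (T : measurableType d') (I : choiceType)
    (Z : I -> {RV Pr >-> T}) : Prop :=
  forall (s : seq I) (B : I -> set T), uniq s ->
    (forall j, measurable (B j)) ->
    Pr (\bigcap_(j in [set` s]) (Z j @^-1` B j)) =
    (\prod_(j <- s) Pr (Z j @^-1` B j))%E.

Definition identically_distributed d' (T : measurableType d') (I : Type)
    (Z : I -> {RV Pr >-> T}) : Prop :=
  forall (j k : I) (B : set T), measurable B ->
    distribution Pr (Z j) B = distribution Pr (Z k) B.

(* The sequence is indexed from 0: Z j is the waiting time between the j-th
   and the (j+1)-st arrival. *)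
Definition prabhakar_waiting_times (alpha nu xi : R)
    (Z : nat -> {RV Pr >-> nat}) : Prop :=
  [/\ forall j w, (0 < Z j w)%N,
      mutually_independent Z,
      identically_distributed Z &
      forall j (u : R[i]), `|u| <= 1 ->
        cexpectation (fun w => u ^+ Z j w) = prabhakar_pgf alpha nu xi u].

Variable Z : nat -> {RV Pr >-> nat}.

Definition arrival_time (n : nat) (w : Omega) : nat := (\sum_(j < n) Z j w)%N.

Definition state_probability (n t : nat) : R :=
  fine (Pr [set w | (arrival_time n w <= t < arrival_time n.+1 w)%N]).

Definition walk_matrix N (H : 'M[R]_N) (t : int) : 'M[R]_N :=
  match t with
  | Posz t => \matrix_(i, j)
      limn (series (fun n => (H ^+ n) i j * state_probability n t))
  | Negz _ => 0
  end.

End probability.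

Section graph.
Context (R : realType) (N : nat) (e : rel 'I_N).

Definition adjacency_mx : 'M[R]_N := \matrix_(i, j) (e i j)%:R.

Definition node_degree (i : 'I_N) : R := \sum_j adjacency_mx i j.

(* x / 0 = 0: this matters only for the one-vertex graph, whose matrix is 0. *)
Definition transition_mx : 'M[R]_N :=
  \matrix_(i, j) (adjacency_mx i j / node_degree i).

End graph.

Definition backshift (R : realType) (g : int -> R) : int -> R :=
  fun t => g (t - 1).

Definition Theta (R : realType) (t : int) : R := if 0 <= t then 1 else 0.

Definition causal_convolution (R : realType) (K : nat -> R) (g : int -> R)
    (t : int) : R :=
  match t with
  | Posz t => \sum_(0 <= k < t.+1) K k * g (t%:Z - k%:Z)
  | Negz _ => 0
  end.

(* Main.v *)
Require Import Defs.
From mathcomp Require Import all_boot all_order all_algebra.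
From mathcomp Require Import all_classical all_reals all_analysis.
From mathcomp Require Import measurable_realfun complex.
From mathcomp Require Import ring lra.

Set Implicit Arguments.
Unset Strict Implicit.
Unset Printing Implicit Defensive.

Import Order.TTheory GRing.Theory Num.Theory.
Import numFieldNormedType.Exports.

Local Open Scope classical_set_scope.
Local Open Scope ring_scope.
Local Open Scope complex_scope.

(** On real u in ]0, 1[ the kernel generating function k and the waiting-time
    generating function g satisfy (1 - u) k(u) g(u) = u. Coefficients being
    determined by the germ at 0^+, the truncations Kp and W of the two power
    series satisfy (1 - X) Kp W = X modulo X^T. By independence the law of J_n
    is given by the coefficients of W^n, hence Phi^(n)(t) is the coefficient
    of X^t in W^n (1 - W) (1 + X + ... + X^(T-1)) for t < T. Multiplication by
    (1 - X) Kp therefore shifts Phi^(n) to X Phi^(n-1) for n > 0, and sends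
    Phi^(0) to Kp - X/(1 - X); summing against H^n gives the equation. As
    Phi^(n)(t) = 0 for n > t, all the series in n are finite sums. *)

(** * Expansions at 0 from the right, modulo a power of the variable *)

Section RightExpansion.
Context {R : realType}.
Implicit Types (f g : R -> R) (p q : {poly R}) (n : nat).

(** The approximation is one-sided because the generating functions are used only at real u in ]0,
    1[, where the principal powers are ordinary real powers. *)
Definition poly_approx n f p :=
  exists C : R, \forall u \near (0 : R)^'+, `|f u - p.[u]| <= C * u ^+ n.

Lemma near_right_itv01 : \forall u \near (0 : R)^'+, 0 < u < 1.
Proof.
near=> u; apply/andP; split; near: u.
- exact: nbhs_right_gt.
- exact: nbhs_right_lt.
Unshelve. all: by end_near. Qed.

Lemma poly_bounded01 p :
  exists2 B : R, 0 <= B & forall u, 0 < u < 1 -> `|p.[u]| <= B.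
Proof.
elim/poly_ind: p => [|p c [B B0 pB]].
  by exists 0 => // u _; rewrite horner0 normr0.
exists (B + `|c|); first by rewrite addr_ge0.
move=> u u01; rewrite hornerMXaddC (le_trans (ler_normD _ _))// lerD2r normrM.
have /andP[u0 u1] := u01.
by rewrite -[leRHS]mulr1 ler_pM// ?pB// gtr0_norm// ltW.
Qed.

(** Write f g - p q = (f - p) g + p (g - q). Near 0 the polynomials are bounded, and g is bounded by
    [Bq + |D|] because u^n <= 1. *)
Lemma poly_approxM n f g p q : poly_approx n f p -> poly_approx n g q ->
  poly_approx n (f \* g) (p * q).
Proof.
move=> [C fp] [D gq].
have [Bp Bp0 pB] := poly_bounded01 p; have [Bq Bq0 qB] := poly_bounded01 q.
exists (`|C| * (Bq + `|D|) + Bp * `|D|).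
near=> u; rewrite /= hornerM.
have u01 : 0 < u < 1 by near: u; exact: near_right_itv01.
have un0 : 0 <= u ^+ n by rewrite exprn_ge0//; case/andP: u01 => /ltW.
have un1 : u ^+ n <= 1.
  by case/andP: u01 => u0 u1; rewrite exprn_ile1// ltW.
have fu : `|f u - p.[u]| <= `|C| * u ^+ n.
  rewrite (@le_trans _ _ (C * u ^+ n))//; first by near: u.
  by rewrite ler_wpM2r// ler_norm.
have gu : `|g u - q.[u]| <= `|D| * u ^+ n.
  rewrite (@le_trans _ _ (D * u ^+ n))//; first by near: u.
  by rewrite ler_wpM2r// ler_norm.
have gB : `|g u| <= Bq + `|D|.
  rewrite -[g u](subrK q.[u]) addrC (le_trans (ler_normD _ _))// lerD ?qB//.
  by rewrite (le_trans gu)// ler_piMr.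
have -> : f u * g u - p.[u] * q.[u] =
    (f u - p.[u]) * g u + p.[u] * (g u - q.[u]) by ring.
rewrite (le_trans (ler_normD _ _))// !normrM mulrDl lerD//.
  by rewrite mulrAC ler_pM.
by rewrite -mulrA ler_pM ?pB.
Unshelve. all: by end_near. Qed.

Lemma poly_approx_refl n p : poly_approx n (horner p) p.
Proof. by exists 0; near=> u; rewrite subrr normr0 mul0r.
Unshelve. all: by end_near. Qed.

(** The difference p - q is O(u^n) at 0^+. By induction on n, letting u tend to 0 kills its constant
    coefficient, and dividing by u lowers the order by one. *)
Lemma poly_approx_uniq n f p q : poly_approx n f p -> poly_approx n f q ->
  forall k, (k < n)%N -> p`_k = q`_k.
Proof.
move=> [C fp] [D fq] k kn; apply/eqP; rewrite -subr_eq0 -coefB.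
have {fp fq f} : exists C, \forall u \near (0 : R)^'+,
    `|(p - q).[u]| <= C * u ^+ n.
  exists (C + D); near=> u; rewrite hornerD hornerN mulrDl.
  rewrite -(subrK (f u) p.[u]) -addrA (le_trans (ler_normD _ _))//.
  by rewrite lerD//; [rewrite distrC|]; near: u.
move: {p q C D}(p - q) => p [C].
elim: n k kn p C => // n IH k kn p C; elim/poly_ind: p k kn => [|p c _] k kn pC.
  by rewrite coef0.
have [B B0 pB] := poly_bounded01 p.
have c0 : c = 0.
  apply/eqP; rewrite -normr_le0; apply/ler_addgt0Pl => e e0; rewrite addr0.
  (* [|C|] pays for the error C u^(n+1), [B] for the nonconstant part p(u) u, and the 1 makes M
     positive so that e / M makes sense. *)
  pose M := `|C| + B + 1; have M0 : 0 < M by rewrite ltr_wpDl// addr_ge0.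
  near (0 : R)^'+ => u.
  have u01 : 0 < u < 1 by near: u; exact: near_right_itv01.
  have /andP[u0 u1] := u01.
  have ueM : u < e / M by near: u; apply: nbhs_right_lt; rewrite divr_gt0.
  apply: (@le_trans _ _ (M * u)); last by rewrite mulrC -ler_pdivlMr// ltW.
  have -> : c = (p * 'X + c%:P).[u] - p.[u] * u by rewrite hornerMXaddC; ring.
  rewrite (le_trans (ler_normB _ _))// !mulrDl mul1r ler_wpDr ?(ltW u0)//.
  rewrite lerD//; last by rewrite normrM (gtr0_norm u0) ler_wpM2r ?pB// ltW.
  apply: (@le_trans _ _ (C * u ^+ n.+1)); first by near: u.
  rewrite (@le_trans _ _ (`|C| * u ^+ n.+1))//.
    by rewrite ler_wpM2r ?ler_norm// exprn_ge0// ltW.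
  by rewrite ler_wpM2l// exprS ler_piMr ?(ltW u0)// exprn_ile1// ltW.
rewrite c0 addr0 coefMX; case: k kn => //= k kn; apply: (IH _ _ _ C) => //.
near=> u.
have u0 : 0 < u by near: u; exact: nbhs_right_gt.
have : `|(p * 'X + c%:P).[u]| <= C * u ^+ n.+1 by near: u.
by rewrite hornerMXaddC c0 addr0 normrM (gtr0_norm u0) exprSr mulrA ler_pM2r.
Unshelve. all: by end_near. Qed.

(* Boundedness of the terms at one u0 > 0 dominates the remainder by a
   geometric series on ]0, u0 / 2[. *)
Lemma power_series_approx n (a : nat -> R) f :
  (\forall u \near (0 : R)^'+,
     series (fun k => a k * u ^+ k) @ \oo --> f u) ->
  poly_approx n f (\poly_(k < n) a k).
Proof.
move=> af.
have : \forall u \near (0 : R)^'+,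
    0 < u /\ series (fun k => a k * u ^+ k) @ \oo --> f u.
  by near=> u; split; near: u; [exact: nbhs_right_gt|exact: af].
move=> /filter_ex[v [v0 cv]].
have /cvg_series_bounded/pinfty_ex_gt0[M /ltW M0 aM] :
    cvgn (series (fun k => a k * v ^+ k)) by apply/cvg_ex; exists (f v).
(* With x = u / v <= 1/2, the tail is at most M x^n / (1 - 1/2), and x^n = u^n / v^n. *)
exists (2 * M / v ^+ n); near=> u.
have u0 : 0 < u by near: u; exact: nbhs_right_gt.
have u2 : u < v / 2 by near: u; apply: nbhs_right_lt; rewrite divr_gt0.
have cu : series (fun k => a k * u ^+ k) @ \oo --> f u by near: u.
pose x := u / v; have x0 : 0 <= x by rewrite divr_ge0 // ltW.
have x2 : x <= 2^-1 by rewrite ler_pdivrMr// mulrC ltW.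
have ax k : `|a k * u ^+ k| <= M * x ^+ k.
  have -> : u ^+ k = v ^+ k * x ^+ k by rewrite -exprMn mulrC divfK ?gt_eqF.
  rewrite mulrA normrM [`|x ^+ k|]ger0_norm ?exprn_ge0//.
  by rewrite ler_wpM2r ?exprn_ge0// aM.
(* Subtracting the unspent part of the geometric sum is what lets the induction on j close. *)
have tail j : `|series (fun k => a k * u ^+ k) (j + n)%N
               - series (fun k => a k * u ^+ k) n|
    <= 2 * M * x ^+ n - 2 * M * x ^+ n * 2^-1 ^+ j.
  elim: j => [|j IHj]; first by rewrite subrr normr0 expr0 mulr1 subrr.
  rewrite addSn seriesS -addrA (le_trans (ler_normD _ _))//.
  apply: le_trans (lerD (ax _) IHj) _.
  have : M * x ^+ (j + n) <= M * x ^+ n * 2^-1 ^+ j.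
    rewrite -mulrA ler_wpM2l// addnC exprD ler_wpM2l ?exprn_ge0//.
    by rewrite lerXn2r// nnegrE.
  rewrite exprS; move: (M * x ^+ (j + n)) (2^-1 ^+ j) => A B; lra.
have -> : (\poly_(k < n) a k).[u] = series (fun k => a k * u ^+ k) n.
  by rewrite horner_poly /series /= big_mkord.
have -> : 2 * M / v ^+ n * u ^+ n = 2 * M * x ^+ n.
  by rewrite -mulrA -exprVn -exprMn (mulrC v^-1).
have cvd : `|series (fun k => a k * u ^+ k) (j + n)%N
     - series (fun k => a k * u ^+ k) n| @[j --> \oo]
    --> `|f u - series (fun k => a k * u ^+ k) n|.
  apply: cvg_norm; apply: cvgB; last exact: cvg_cst.
  by rewrite (@cvg_shiftn n _ (series (fun k => a k * u ^+ k))).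
apply: (cvgr_to_le cvd); near=> j; rewrite (le_trans (tail j))//.
by rewrite gerBl !mulr_ge0// exprn_ge0 ?invr_ge0.
Unshelve. all: by end_near. Qed.

End RightExpansion.

(** * From complex to real generating functions *)

Section RealRestriction.
Context {R : realType}.
Implicit Types (u x a : R).

Lemma normc_real x : Normc.normc x%:C = `|x|.
Proof. by rewrite /Normc.normc /= expr0n addr0 sqrtr_sqr. Qed.

Lemma cpow_real x a : 0 < x -> cpow x%:C a = (x `^ a)%:C.
Proof.
move=> x0; rewrite /cpow normc_real gtr0_norm// /carg normc_real gtr0_norm//=.
by rewrite divff ?gt_eqF// acos1 lexx mulr0 cos0 sin0 mulr1.
Qed.

Definition real_pgf (alpha nu xi u : R) : R :=
  xi `^ nu * u / (xi + (1 - u) `^ alpha) `^ nu.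

Definition real_kernel_gf (alpha nu xi u : R) : R :=
  (1 - u)^-1 * (1 + (1 - u) `^ alpha / xi) `^ nu.

Lemma prabhakar_pgf_real alpha nu xi u : 0 < xi -> u < 1 ->
  prabhakar_pgf alpha nu xi u%:C = (real_pgf alpha nu xi u)%:C.
Proof.
move=> xi0 u1; rewrite /prabhakar_pgf.
have -> : 1 - u%:C = (1 - u)%:C by rewrite rmorphB rmorph1.
rewrite cpow_real ?subr_gt0// -rmorphD cpow_real ?addr_gt0 ?powR_gt0 ?subr_gt0//.
by rewrite /real_pgf !rmorphM fmorphV.
Qed.

Lemma prabhakar_kernel_gf_real alpha nu xi u : 0 < xi -> u < 1 ->
  prabhakar_kernel_gf alpha nu xi u%:C = (real_kernel_gf alpha nu xi u)%:C.
Proof.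
move=> xi0 u1; rewrite /prabhakar_kernel_gf.
have -> : 1 - u%:C = (1 - u)%:C by rewrite rmorphB rmorph1.
rewrite cpow_real ?subr_gt0//.
have -> : 1 + ((1 - u) `^ alpha)%:C / xi%:C = (1 + (1 - u) `^ alpha / xi)%:C.
  by rewrite rmorphD rmorphM fmorphV rmorph1.
rewrite cpow_real; first by rewrite /real_kernel_gf rmorphM fmorphV.
by rewrite addr_gt0// divr_gt0// powR_gt0// subr_gt0.
Qed.

(** Factoring xi + c = xi (1 + c / xi), with c = (1 - u)^alpha, makes the nu-th powers in the two
    functions cancel. *)
Lemma real_kernel_gf_pgf alpha nu xi u : 0 < xi -> u < 1 ->
  (1 - u) * real_kernel_gf alpha nu xi u * real_pgf alpha nu xi u = u.
Proof.
move=> xi0 u1; rewrite /real_kernel_gf /real_pgf.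
have u10 : 0 < 1 - u by rewrite subr_gt0.
have c0 : 0 < (1 - u) `^ alpha by rewrite powR_gt0.
move: c0; set c := (1 - u) `^ alpha => c0.
have -> : xi + c = xi * (1 + c / xi) by field; rewrite gt_eqF.
have c10 : 0 < 1 + c / xi by rewrite addr_gt0// divr_gt0.
rewrite powRM ?(ltW xi0) ?(ltW c10)//.
have := powR_gt0 nu c10; have := powR_gt0 nu xi0.
move: (1 + c / xi) => y; move: (y `^ nu) (xi `^ nu) => a b b0 a0.
by field; rewrite !gt_eqF.
Qed.

Lemma has_power_series_at0_real (a : nat -> R) (F : R[i] -> R[i]) (f : R -> R) :
  has_power_series_at0 (fun k => (a k)%:C) F ->
  (forall u, 0 < u < 1 -> F u%:C = (f u)%:C) ->
  \forall u \near (0 : R)^'+, series (fun k => a k * u ^+ k) @ \oo --> f u.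
Proof.
move=> aF Ff; have /nbhs_ballP[[r ri] /= r0 rF] := aF.
(* The radius of the ball is a complex number; its positivity forces its imaginary part to
   vanish. *)
move: r0; rewrite ltcE /= => /andP[/eqP r0i r0]; subst ri.
near=> u.
have u01 : 0 < u < 1 by near: u; exact: near_right_itv01.
have /andP[u0 u1] := u01.
have ur : u < r by near: u; exact: nbhs_right_lt.
have /rF : ball (0 : R[i]^o) (r +i* 0)%C u%:C.
  by rewrite -ball_normE /= sub0r normrN normc_def /= expr0n addr0 sqrtr_sqr
    gtr0_norm// ltcR.
rewrite Ff// => cu; apply/cvgrPdist_lt => e e0.
move/cvgrPdist_lt : cu => /(_ e%:C); rewrite ltcR => /(_ e0).
apply: filterS => n.
have -> : series (fun k => (a k)%:C * u%:C ^+ k : R[i]^o) n =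
    (series (fun k => a k * u ^+ k) n)%:C.
  rewrite /series /= rmorph_sum; apply: eq_bigr => k _.
  by rewrite rmorphM rmorphXn.
by rewrite -rmorphB normc_def /= expr0n addr0 sqrtr_sqr ltcR.
Unshelve. all: by end_near. Qed.

End RealRestriction.

(** * Law of one waiting time *)

Section WaitingTimes.
Context d (Omega : measurableType d) (R : realType) (Pr : probability Omega R).

Definition pmf (X : {RV Pr >-> nat}) (k : nat) : R :=
  fine (Pr (X @^-1` [set k])).

Lemma measurable_preimage_nat (X : {RV Pr >-> nat}) (B : set nat) :
  measurable (X @^-1` B).
Proof. by rewrite -[_ @^-1` _]setTI; exact: measurable_funPT. Qed.

Lemma pmfE (X : {RV Pr >-> nat}) k : (pmf X k)%:E = Pr (X @^-1` [set k]).
Proof. by rewrite fineK// fin_num_measure//; exact: measurable_preimage_nat. Qed.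

Lemma probability_gt_nat (X : {RV Pr >-> nat}) m :
  Pr (X @^-1` [set k | (m < k)%N]) = (1 - \sum_(k < m.+1) pmf X k)%:E.
Proof.
have -> : X @^-1` [set k | (m < k)%N] =
    ~` \big[setU/set0]_(k < m.+1) (X @^-1` [set (k : nat)]).
  rewrite -(bigcup_mkord _ (fun k => X @^-1` [set k])).
  apply/seteqP; split=> w /=.
    by move=> mX [k /= km Xk]; move: mX; rewrite Xk ltnNge -ltnS km.
  by move=> H; rewrite ltnNge; apply/negP => Xm; apply: H; exists (X w).
rewrite probability_setC; last first.
  by apply: bigsetU_measurable => k _; exact: measurable_preimage_nat.
rewrite (measure_bigsetU _ (F := fun k => X @^-1` [set k])); first last.
- exact: trivIset_preimage1.
- by move=> k; exact: measurable_preimage_nat.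
by rewrite EFinB -sumEFin; congr (_ - _)%E; apply: eq_bigr => k _; rewrite pmfE.
Qed.

(** The level sets of X partition the space and u^X is constant on each, so countable additivity of
    the integral of a nonnegative function gives the series. *)
Lemma pmf_series (X : {RV Pr >-> nat}) (u : R) : 0 < u < 1 ->
  series (fun k => pmf X k * u ^+ k) @ \oo -->
  fine ('E_Pr[fun w => (u ^+ X w)%R])%E.
Proof.
move=> /andP[u0 u1]; rewrite unlock.
have mX : measurable_fun [set: Omega] (fun w => (u ^+ X w)%:E).
  by apply: (measurableT_comp (f := fun k : nat => (u ^+ k)%:E)).
have cover : setT = \bigcup_k (X @^-1` [set k]).
  by apply/seteqP; split=> // w _; exists (X w).
have int_sum : (\int[Pr]_w (u ^+ X w)%:E =
    \sum_(0 <= k <oo) (pmf X k * u ^+ k)%:E)%E.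
  rewrite cover ge0_integral_bigcup -?cover//; first last.
  - exact: trivIset_preimage1.
  - by move=> w _; rewrite lee_fin exprn_ge0// ltW.
  - by move=> k; exact: measurable_preimage_nat.
  apply: eq_eseriesr => k _.
  rewrite (eq_integral (cst (u ^+ k)%:E)); last first.
    by move=> w; rewrite inE /= => ->.
  rewrite integral_cst//; last exact: measurable_preimage_nat.
  by rewrite EFinM pmfE muleC.
(* The integrand is at most 1, so the expectation is finite and [fine] loses nothing. *)
have fin : (\int[Pr]_w (u ^+ X w)%:E)%E \is a fin_num.
  rewrite ge0_fin_numE; last first.
    by apply: integral_ge0 => w _; rewrite lee_fin exprn_ge0// ltW.
  rewrite (@le_lt_trans _ _ (\int[Pr]_w (cst 1%E w))%E)//; last first.
    rewrite integral_cst// mul1e -[X in (X < _)%E]/(Pr setT).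
    by rewrite probability_setT ltry.
  apply: ge0_le_integral => //.
  - by move=> w _; rewrite lee_fin exprn_ge0// ltW.
  - by move=> w _; rewrite lee_fin exprn_ile1// ltW.
suff cv : EFin \o series (fun k => pmf X k * u ^+ k) @ \oo -->
    (fine (\int[Pr]_w (u ^+ X w)%:E)%E)%:E by exact: (fine_cvg cv).
rewrite fineK// int_sum.
rewrite (_ : _ \o _ = fun n => (\sum_(0 <= k < n) (pmf X k * u ^+ k)%:E)%E).
  apply: is_cvg_nneseries => k _ _.
  by rewrite lee_fin mulr_ge0 ?exprn_ge0 ?(ltW u0)// fine_ge0.
by apply/funext => n; rewrite /= sumEFin.
Qed.

(** At real u the assumed identity has real values on both sides, and its real part identifies the
    expectation of u^Z with the real generating function. *)
Lemma prabhakar_pmf_series (alpha nu xi : R) (Z : nat -> {RV Pr >-> nat}) j u :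
  0 < xi -> prabhakar_waiting_times alpha nu xi Z -> 0 < u < 1 ->
  series (fun k => pmf (Z j) k * u ^+ k) @ \oo --> real_pgf alpha nu xi u.
Proof.
move=> xi0 [_ _ _ gf] u01; have /andP[u0 u1] := u01.
have := gf j u%:C; rewrite normc_def /= expr0n addr0 sqrtr_sqr gtr0_norm//.
rewrite -[1]/(1%:C) lecR (ltW u1) => /(_ isT) /(congr1 (@complex.Re R)).
rewrite prabhakar_pgf_real//= => <-.
rewrite (_ : (fun w => complex.Re _) = (fun w => u ^+ Z j w)).
  exact: pmf_series.
by apply/funext => w; rewrite -rmorphXn.
Qed.

End WaitingTimes.

(** * Laws of the arrival times and state probabilities *)

Section ArrivalTimes.
Context d (Omega : measurableType d) (R : realType) (Pr : probability Omega R).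
Variables (Z : nat -> {RV Pr >-> nat}).

Lemma arrival_timeS n w : arrival_time Z n.+1 w = (arrival_time Z n w + Z n w)%N.
Proof. by rewrite /arrival_time big_ord_recr. Qed.

Lemma measurable_arrival_time n : measurable_fun [set: Omega] (arrival_time Z n).
Proof.
elim: n => [|n IH].
  rewrite (_ : arrival_time Z 0 = cst 0%N); first exact: measurable_cst.
  by apply/funext => w; rewrite /arrival_time big_ord0.
rewrite (_ : arrival_time Z n.+1 = fun w => (arrival_time Z n w + Z n w)%N).
  exact: measurable_fun_addn.
by apply/funext => w; rewrite arrival_timeS.
Qed.

Lemma measurable_arrival_timeT n (B : set nat) :
  measurable (arrival_time Z n @^-1` B).
Proof. by rewrite -[_ @^-1` _]setTI; exact: measurable_arrival_time. Qed.

(** Total probability over the values of J_n. It serves both the convolution step for J_(n+1) and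
    the computation of the state probabilities. *)
Lemma measure_arrival_partition n m (A : nat -> set Omega) (E : set Omega) :
  (forall s, measurable (A s)) ->
  (forall w, E w <-> (arrival_time Z n w < m)%N /\ A (arrival_time Z n w) w) ->
  Pr E = (\sum_(s < m) Pr (arrival_time Z n @^-1` [set (s : nat)] `&` A s))%E.
Proof.
move=> mA EA; pose F s := arrival_time Z n @^-1` [set s] `&` A s.
have -> : E = \big[setU/set0]_(s < m) F s.
  rewrite -bigcup_mkord; apply/seteqP; split=> w.
    by move=> /EA[Jm Aw]; exists (arrival_time Z n w).
  by move=> [s /= sm [/= Js Aw]]; apply/EA; rewrite Js.
rewrite measure_bigsetU//.
  by move=> s; apply: measurableI => //; exact: measurable_arrival_timeT.
by apply: trivIset_setIr; exact: trivIset_preimage1.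
Qed.

Hypothesis Z_indep : mutually_independent Z.
Hypothesis Z_id : identically_distributed Z.

Lemma preimage_id_distributed j k (B : set nat) :
  Pr (Z j @^-1` B) = Pr (Z k @^-1` B).
Proof. exact: (Z_id j k). Qed.

Variables (T : nat) (W : {poly R}).
Hypothesis W_pmf : forall k, (k < T)%N -> W`_k = pmf (Z 0%N) k.

(* Arbitrary events on the later waiting times are carried along so that the
   induction step can move Z n into the list l. *)
Lemma arrival_time_indep n s (l : seq nat) (B : nat -> set nat) :
  (s < T)%N -> uniq l -> all (leq n) l ->
  Pr (arrival_time Z n @^-1` [set s] `&`
      \bigcap_(j in [set` l]) (Z j @^-1` B j)) =
  (((W ^+ n)`_s)%:E * \prod_(j <- l) Pr (Z j @^-1` B j))%E.
Proof.
elim: n s l B => [|n IH] s l B sT ul nl.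
  rewrite expr0 coef1; case: s sT => [|s] sT.
    rewrite mul1e (_ : _ @^-1` _ = setT) ?setTI; first exact: Z_indep.
    by apply/seteqP; split=> // w _ /=; rewrite /arrival_time big_ord0.
  rewrite mul0e (_ : _ `&` _ = set0) ?measure0//.
  by rewrite -subset0 => w [/=]; rewrite /arrival_time big_ord0.
pose C := \bigcap_(j in [set` l]) (Z j @^-1` B j).
(* Given J_n = k, the event J_(n+1) = s means Z_n = s - k; this condition joins those on the indices
   in [l], none of which equals n. *)
pose B' k j := if j == n then [set (s - k)%N] else B j.
have nnl : n \notin l by apply/negP => /(allP nl); rewrite ltnn.
have CB k : \bigcap_(j in [set` n :: l]) (Z j @^-1` B' k j) =
    Z n @^-1` [set (s - k)%N] `&` C.
  rewrite (_ : [set` n :: l] = [set n] `|` [set` l]); last first.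
    apply/seteqP; split=> j /=; rewrite inE.
      by case/orP => [/eqP|]; [left|right].
    by case=> [->|->]; rewrite ?eqxx ?orbT.
  rewrite bigcap_setU bigcap_set1 {1}/B' eqxx; congr (_ `&` _).
  apply: eq_bigcapr => j /= jl; rewrite /B'.
  by case: eqP jl => // ->; rewrite (negPf nnl).
rewrite (@measure_arrival_partition n s.+1
    (fun k => \bigcap_(j in [set` n :: l]) (Z j @^-1` B' k j))); first last.
- move=> w; rewrite CB ltnS; split.
    move=> [/=]; rewrite arrival_timeS => <- Cw.
    by rewrite leq_addr addKn.
  move=> [Js [/= Zn Cw]]; split=> //=.
  by rewrite arrival_timeS Zn subnKC.
- move=> k; apply: bigcap_measurableType => j _.
  exact: measurable_preimage_nat.
have Pfin : (\prod_(j <- l) Pr (Z j @^-1` B j))%E \is a fin_num.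
  apply: prode_fin_num => j _; apply: fin_num_measure.
  exact: measurable_preimage_nat.
(* The sum over k becomes the convolution giving the coefficient of W^n W at s. *)
rewrite exprSr coefM -(fineK Pfin) -EFinM mulr_suml -sumEFin.
apply: eq_bigr => k _; have ks : (k <= s)%N by rewrite -ltnS.
rewrite IH ?(leq_ltn_trans ks)//=; last 2 first.
- by rewrite nnl.
- by rewrite leqnn; apply/allP => j /(allP nl)/ltnW.
rewrite big_cons {1}/B' eqxx (preimage_id_distributed n 0) -pmfE -W_pmf; last first.
  by rewrite (leq_ltn_trans (leq_subr _ _)).
rewrite muleA !EFinM fineK//; congr (_ * _)%E; apply: eq_big_seq => j jl.
by rewrite /B'; case: eqP jl => // ->; rewrite (negPf nnl).
Qed.

Lemma probability_arrival_time n s (B : set nat) : (s < T)%N ->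
  Pr (arrival_time Z n @^-1` [set s] `&` Z n @^-1` B) =
  (((W ^+ n)`_s)%:E * Pr (Z 0%N @^-1` B))%E.
Proof.
move=> sT; rewrite (preimage_id_distributed 0 n).
have := @arrival_time_indep n s [:: n] (fun=> B) sT isT.
by rewrite /= leqnn set_cons1 bigcap_set1 big_seq1 => ->.
Qed.

(** Given J_n = s, the state at t is n exactly when Z_n > t - s. The tail probabilities of Z_n have
    generating function (1 - W) / (1 - X), with 1 / (1 - X) truncated here at order T. *)
Lemma state_probabilityE n t : (t < T)%N ->
  state_probability Z n t = (W ^+ n * ((1 - W) * \poly_(k < T) 1))`_t.
Proof.
move=> tT; rewrite /state_probability.
rewrite (@measure_arrival_partition n t.+1
    (fun s => Z n @^-1` [set k | (t - s < k)%N])); first last.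
- move=> w /=; rewrite arrival_timeS ltnS; split.
    by move=> /andP[Jt tJ]; rewrite ltn_subLR.
  by move=> [Jt]; rewrite ltn_subLR// Jt.
- by move=> s; exact: measurable_preimage_nat.
under eq_bigr => s _.
  rewrite probability_arrival_time ?(leq_trans (ltn_ord s))//.
  rewrite probability_gt_nat -EFinM.
  over.
rewrite sumEFin /= coefM; apply: eq_bigr => s _; congr (_ * _).
have tsT : (t - s < T)%N by rewrite (leq_ltn_trans (leq_subr _ _)).
(* Multiplying by the truncated geometric series sums the coefficients of 1 - W up to t - s; the
   constant 1 contributes only at index 0. *)
rewrite [RHS]coefM [RHS](eq_bigr (fun k : 'I_(t - s).+1 => (1 - W)`_k)); last first.
  move=> k _; rewrite coef_poly ifT ?mulr1//.
  by rewrite (leq_ltn_trans (leq_subr _ _)).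
under [RHS]eq_bigr => k _ do rewrite coefB coef1.
rewrite sumrB [X in _ = X - _](bigD1 ord0)//= [X in _ + X - _]big1 ?addr0; last first.
  by move=> k; rewrite -val_eqE => /negPf /= ->.
congr (_ - _); apply: eq_bigr => k _.
by rewrite W_pmf// (leq_trans (ltn_ord k)).
Qed.

(** Waiting times are at least 1, hence J_n >= n. *)
Lemma state_probability_gt n t : (forall j w, (0 < Z j w)%N) -> (t < n)%N ->
  state_probability Z n t = 0.
Proof.
move=> Z0 tn; rewrite /state_probability (_ : [set w | _] = set0) ?measure0//.
rewrite -subset0 => w /= /andP[Jt _]; move: Jt; apply/negP; rewrite -ltnNge.
rewrite (leq_trans tn)// -[n in (n <= _)%N]card_ord -sum1_card.
by apply: leq_sum => j _.
Qed.

(** The partial sums are stationary from rank M on, since the terms with n > s vanish. The cutoffs T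
    and M are left free so that sums at different times can be written with the same polynomials. *)
Lemma walk_matrixE N (H : 'M[R]_N) M s i j :
  (forall j w, (0 < Z j w)%N) -> (s < T)%N -> (s < M)%N ->
  walk_matrix Z H s i j =
  (\sum_(n < M) (H ^+ n) i j *: (W ^+ n * ((1 - W) * \poly_(k < T) 1)))`_s.
Proof.
move=> Z0 sT sM; rewrite mxE coef_sum; apply: lim_near_cst => //.
exists M => // m /= Mm; rewrite /series /=.
rewrite -(subnKC Mm) big_mkord big_split_ord/= [X in _ + X]big1 ?addr0.
  by apply: eq_bigr => n _; rewrite coefZ -state_probabilityE.
move=> n _; rewrite state_probability_gt ?mulr0//.
by rewrite (leq_trans sM)// leq_addr.
Qed.

End ArrivalTimes.

(** * The renewal recursion for truncated series *)

Section Recursion.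
Variables (R : realType).

(** An explicit multiple of X^n turns the congruence into an equation that can be rewritten with and
    passed to [ring]. *)
Lemma poly_congr_XnP n (p q : {poly R}) :
  (forall k, (k < n)%N -> p`_k = q`_k) -> exists r, p = q + r * 'X^n.
Proof.
move=> pq; exists (drop_poly n (p - q)); apply/polyP => k.
rewrite coefD coefMXn coef_drop_poly; case: ltnP => [kn|nk].
  by rewrite addr0 pq.
by rewrite subnK// coefB addrC subrK.
Qed.

Lemma coef_addMXn n (p r : {poly R}) k : (k < n)%N -> (p + r * 'X^n)`_k = p`_k.
Proof. by move=> kn; rewrite coefD coefMXn kn addr0. Qed.

Lemma geometric_polyE T : (1 - 'X) * \poly_(k < T) (1 : R) = 1 - 'X^T.
Proof.
have -> : \poly_(k < T) (1 : R) = \sum_(k < T) 'X^k.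
  by rewrite poly_def; apply: eq_bigr => k _; rewrite scale1r.
by rewrite -[in RHS](expr1n _ T) subrXX; congr (_ * _); apply: eq_bigr => k _;
  rewrite expr1n mul1r.
Qed.

(* D = (1 - X) Kp inverts W up to the shift X, which turns the n-th term of
   the left-hand sum into the (n - 1)-st one of the right-hand sum. *)
Lemma renewal_recursion T (W Kp : {poly R}) (h : nat -> R) t : (t < T)%N ->
  (forall k, (k < T)%N -> ((1 - 'X) * Kp * W)`_k = 'X`_k) ->
  let V := (1 - W) * \poly_(k < T) 1 in
  ((1 - 'X) * (Kp * \sum_(n < T.+1) h n *: (W ^+ n * V)))`_t
    - h 0%N * (Kp`_t - (0 < t)%N%:R)
  = ('X * \sum_(n < T) h n.+1 *: (W ^+ n * V))`_t.
Proof.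
move=> tT /poly_congr_XnP[Q DW] V; set E := \poly_(k < T) 1 in V *.
(* Modulo X^T, D V = Kp (1 - X) E - D W E, where (1 - X) E = 1 and D W = X. *)
have DV : (1 - 'X) * Kp * V = Kp - 'X * E + (- Kp - Q * E) * 'X^T.
  transitivity (Kp * ((1 - 'X) * E) - (1 - 'X) * Kp * W * E).
    by rewrite /V; ring.
  by rewrite DW geometric_polyE; ring.
(* The term n = 0 is split off; in every other term one factor W is absorbed by D W = X + Q X^T. *)
have -> : (1 - 'X) * (Kp * \sum_(n < T.+1) h n *: (W ^+ n * V)) =
    h 0%N *: ((1 - 'X) * Kp * V) + 'X * (\sum_(n < T) h n.+1 *: (W ^+ n * V))
    + Q * (\sum_(n < T) h n.+1 *: (W ^+ n * V)) * 'X^T.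
  rewrite big_ord_recl expr0 mul1r mulrA mulrDr -scalerAr -addrA; congr (_ + _).
  rewrite [in RHS]mulrAC -mulrDl -DW !mulr_sumr; apply: eq_bigr => n _.
  by rewrite -!scalerAr exprS; congr (_ *: _); ring.
rewrite coef_addMXn// coefD coefZ DV coef_addMXn// coefB coefXM coef_poly.
(* The coefficient of X E at t is 0 for t = 0 and 1 for 0 < t < T, which is the indicator in the
   statement, so the h 0 contributions cancel. *)
case: t tT => [|t] tT /=; first by rewrite addrAC subrr add0r.
by rewrite (ltnW tT) addrAC subrr add0r.
Qed.

(** The product of the truncations approximates (1 - u) k(u) g(u) = u to order T, and so does X;
    uniqueness of the expansion compares coefficients. *)
Lemma kernel_pmf_coef (alpha nu xi : R) T (w K : nat -> R) : 0 < xi ->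
  (\forall u \near (0 : R)^'+,
     series (fun k => K k * u ^+ k) @ \oo --> real_kernel_gf alpha nu xi u) ->
  (\forall u \near (0 : R)^'+,
     series (fun k => w k * u ^+ k) @ \oo --> real_pgf alpha nu xi u) ->
  forall k, (k < T)%N ->
    ((1 - 'X) * \poly_(k < T) K k * \poly_(k < T) w k)`_k = 'X`_k.
Proof.
move=> xi0 Kf wf.
have := poly_approxM (poly_approxM (poly_approx_refl T (1 - 'X))
  (power_series_approx T Kf)) (power_series_approx T wf).
move=> /poly_approx_uniq; apply; exists 0; near=> u.
have u1 : u < 1 by near: u; exact: nbhs_right_lt.
rewrite /= hornerD hornerN hornerC hornerX real_kernel_gf_pgf//.
by rewrite subrr normr0 mul0r.
Unshelve. all: by end_near. Qed.

End Recursion.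

(** * The Kolmogorov-Feller equation *)

Theorem mainTheorem11 (R : realType) (alpha nu xi : R)
  (alpha_gt0 : 0 < alpha) (alpha_le1 : alpha <= 1)
  (nu_gt0 : 0 < nu) (xi_gt0 : 0 < xi)
  (N : nat) (e : rel 'I_N)
  (e_sym : symmetric e) (e_irr : irreflexive e)
  (e_connected : forall i j : 'I_N, connect e i j)
  (d : measure_display) (Omega : measurableType d) (Pr : probability Omega R)
  (Z : nat -> {RV Pr >-> nat})
  (Z_prabhakar : prabhakar_waiting_times alpha nu xi Z)
  (K : nat -> R)
  (K_coef : has_power_series_at0 (fun k => (K k)%:C)
              (prabhakar_kernel_gf alpha nu xi)) :
  let H : 'M[R]_N := transition_mx R e in
  let P : int -> 'M[R]_N := walk_matrix Z H in
  (forall i j : 'I_N, P 0 i j = (i == j)%:R) /\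
  (forall (t : nat) (i j : 'I_N),
     let S : int -> R := causal_convolution K (fun s : int => P s i j) in
     (S t%:Z - backshift S t%:Z)
       - (i == j)%:R * (K t - Theta R (t%:Z - 1))
     = \sum_(r < N) H i r * P (t%:Z - 1) r j).
Proof.
move=> H P; have [Z0 Zi Zd _] := Z_prabhakar.
have Ks : \forall u \near (0 : R)^'+,
    series (fun k => K k * u ^+ k) @ \oo --> real_kernel_gf alpha nu xi u.
  apply: (has_power_series_at0_real K_coef) => u /andP[_ u1].
  exact: prabhakar_kernel_gf_real.
have ws : \forall u \near (0 : R)^'+,
    series (fun k => pmf (Z 0%N) k * u ^+ k) @ \oo --> real_pgf alpha nu xi u.
  near=> u; apply: (prabhakar_pmf_series _ xi_gt0 Z_prabhakar).
  by near: u; exact: near_right_itv01.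
pose W T := \poly_(k < T) pmf (Z 0%N) k.
have WE T k : (k < T)%N -> (W T)`_k = pmf (Z 0%N) k.
  by move=> kT; rewrite coef_poly kT.
have PE T M (s : nat) i j : (s < T)%N -> (s < M)%N -> P s i j =
    (\sum_(n < M) (H ^+ n) i j *: (W T ^+ n * ((1 - W T) * \poly_(k < T) 1)))`_s.
  exact: (walk_matrixE Zi Zd (WE T) H i j Z0).
split=> [i j|t i j S].
  (* At time 0 only n = 0 survives, with coefficient 1 - W_0, and W_0 = 0 because waiting times are
     positive. *)
  rewrite (PE 1%N 1%N)// big_ord1 /= !expr0 mul1r coefZ mxE.
  rewrite coefM big_ord1 coef_poly/= mulr1 coefB coef1 WE//.
  rewrite /pmf (_ : _ @^-1` _ = set0) ?measure0 ?subr0 ?mulr1//.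
  by rewrite -subset0 => w /= Zw; have := Z0 0%N w; rewrite Zw.
pose V := (1 - W t.+1) * \poly_(k < t.+1) 1.
pose Kp := \poly_(k < t.+1) K k.
(* The [t.+2] terms match the left-hand sum of [renewal_recursion] at T = t + 1. *)
pose Pp := \sum_(n < t.+2) (H ^+ n) i j *: (W t.+1 ^+ n * V).
have SE (s : nat) : (s <= t)%N -> S s = (Kp * Pp)`_s.
  move=> st; rewrite /S /= big_mkord coefM; apply: eq_bigr => k _.
  have ks : (k <= s)%N by rewrite -ltnS.
  rewrite coef_poly ifT; last by rewrite ltnS (leq_trans ks).
  have skt : (s - k <= t)%N by rewrite (leq_trans (leq_subr _ _)).
  by rewrite subzn// (PE t.+1 t.+2)// ltnS leqW.
have -> : S t%:Z - backshift S t%:Z = ((1 - 'X) * (Kp * Pp))`_t.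
  rewrite mulrBl mul1r coefB coefXM SE//; congr (_ - _).
  (* For t = 0 the shifted sum is taken at -1, where it is 0 by definition, like the coefficient of
     X times a polynomial at 0. *)
  case: (t) SE => [//|s] SE.
  by rewrite /backshift intS addrC addKr SE.
have -> : K t - Theta R (t%:Z - 1) = Kp`_t - (0 < t)%N%:R.
  rewrite coef_poly ltnSn; congr (_ - _); case: (t) => [//|s].
  by rewrite /Theta intS addrC addKr.
have -> : (i == j)%:R = (H ^+ 0) i j :> R by rewrite expr0 mxE.
rewrite (renewal_recursion (fun n => (H ^+ n) i j))//; last first.
  exact: (kernel_pmf_coef xi_gt0 Ks ws).
(* At t = 0 both sides vanish, the right one because P(-1) = 0. *)
rewrite coefXM; case: (t) => [|s].
  rewrite eqxx big1// => r _.
  by rewrite (_ : P _ r j = 0) ?mulr0//= mxE.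
have -> : s.+1%:Z - 1 = s%:Z by rewrite intS addrC addKr.
rewrite [LHS]/= coef_sum.
(* Both cutoffs are [s.+2], that is t + 1, so that both sides involve the same truncation W and the
   same range of n; then H^(n+1) = H H^n is expanded entrywise. *)
under [RHS]eq_bigr => r _.
  rewrite (PE s.+2 s.+2) ?ltnS ?leqnSn// coef_sum mulr_sumr.
  over.
rewrite exchange_big; apply: eq_bigr => n _ /=.
have -> : (H ^+ n.+1) i j = \sum_r H i r * (H ^+ n) r j.
  by rewrite exprS [LHS]mxE.
rewrite coefZ mulr_suml; apply: eq_bigr => r _.
by rewrite coefZ -mulrA.
Unshelve. all: by end_near. Qed.
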